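(* Let $K\subset\mathbb R^n$ be a generating set, and let $X\subset\mathbb R^n$ be a finite set of points having a translate contained in $K$ (equivalently, $X$ is contained in a translate of $K$). Then $$\operatorname{conv}_K (X)\setminus \operatorname{conv} X \subseteq \bigcup_{Y\subseteq X,\ |Y|\le n} \operatorname{conv}_K (Y),$$ where $\operatorname{conv} X$ is the ordinary convex hull of $X$ and $\operatorname{conv}_K$ is the $K$-strongly convex hull.
   Context: A convex body in $\mathbb R^n$ is a compact convex set with non-empty interior; a convex compactum is a non-empty compact convex set. For sets $K,T\subset\mathbb R^n$ write $$K \ominus T := \bigcap_{t\in T}(K-t),$$ and let $A+B$ denote the Minkowski sum. A convex body $K\subset\mathbb R^n$ is a generating set if every non-empty intersection of its translates is a Minkowski summand of $K$: for every non-empty $T\subset\mathbb R^n$ with $K\ominus T\neq\emptyset$ there is a convex compactum $T'$ with $(K\ominus T)+T'=K$. A set is $K$-strongly convex if it is an intersection of translates of $K$, i.e. of the form $K\ominus T$. For a set $X$ contained in some translate of $K$, its $K$-strongly convex hull is the minimal $K$-strongly convex set containing $X$; it is given by $\operatorname{conv}_K X = K\ominus(K\ominus X)$, i.e. it is the intersection of all translates of $K$ containing $X$ (with $\operatorname{conv}_K\emptyset=\emptyset$). *)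

(* Defs.v *)
From HB Require Import structures.
From mathcomp Require Import all_boot all_order all_algebra.
From mathcomp Require Import all_classical all_reals all_analysis.

Set Implicit Arguments.
Unset Strict Implicit.
Unset Printing Implicit Defensive.

Import Order.TTheory GRing.Theory Num.Theory.
Import numFieldNormedType.Exports.

Local Open Scope classical_set_scope.
Local Open Scope ring_scope.

Section Lmodule.
Context {R : numDomainType} {V : lmodType R}.
Implicit Types (K T X A B : set V).

Definition minkowski_sum A B : set V := [set a + b | a in A & b in B].

(* For T = set0 this is the empty intersection, i.e. the whole space. *)
Definition minkowski_diff K T : set V :=
  \bigcap_(t in T) [set x - t | x in K].

Definition strongly_convex K A := exists T, A = minkowski_diff K T.

Definition strong_hull K X : set V := minkowski_diff K (minkowski_diff K X).

Definition convex_hull X : set V := smallest (@convex_set R V) X.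

Lemma minkowski_diffP K T x :
  minkowski_diff K T x <-> forall t, T t -> K (x + t).
Proof.
split=> [h t /h[y Ky <-]|h t Tt]; first by rewrite subrK.
by exists (x + t); [exact: h|rewrite addrK].
Qed.

Lemma strong_hull_smallest K X :
  strong_hull K X = smallest (strongly_convex K) X.
Proof.
apply/seteqP; split=> [x /minkowski_diffP hx _ [[T ->] XT]|x].
  apply/minkowski_diffP => t Tt; apply: hx.
  by apply/minkowski_diffP => y /XT/minkowski_diffP/(_ _ Tt); rewrite addrC.
apply; split; first by exists (minkowski_diff K X).
move=> y Xy; apply/minkowski_diffP => t /minkowski_diffP/(_ _ Xy).
by rewrite addrC.
Qed.

Lemma strong_hullE K X :
  strong_hull K X =
  \bigcap_(v in [set v | X `<=` [set x + v | x in K]]) [set x + v | x in K].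
Proof.
have trP v y : [set x + v | x in K] y <-> K (y - v).
  split=> [[x Kx <-]|Ky]; first by rewrite addrK.
  by exists (y - v) => //; rewrite subrK.
apply/seteqP; split=> [x /minkowski_diffP hx v Xv|x hx].
  apply/trP; apply: hx; apply/minkowski_diffP => y /Xv/trP.
  by rewrite addrC.
apply/minkowski_diffP => t /minkowski_diffP ht.
rewrite -[t]opprK; apply/trP; apply: hx => y /ht Ky.
by apply/trP; rewrite opprK addrC.
Qed.

End Lmodule.

Section Euclidean.
Context {R : realType} {n : nat}.
Implicit Types K A : set 'rV[R]_n.

Definition convex_body K :=
  [/\ compact K, @convex_set R 'rV[R]_n K & interior K !=set0].

Definition convex_compactum A :=
  [/\ A !=set0, @convex_set R 'rV[R]_n A & compact A].

Definition generating_set K :=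
  convex_body K /\
  forall T : set 'rV[R]_n, T !=set0 -> minkowski_diff K T !=set0 ->
    exists2 T' : set 'rV[R]_n, convex_compactum T' &
      minkowski_sum (minkowski_diff K T) T' = K.

(* The convention that the strong hull of the empty set is empty follows from
   the formula, except in dimension 0. *)
Lemma strong_hull0 K : (0 < n)%N -> compact K -> strong_hull K set0 = set0.
Proof.
move=> n0 /compact_bounded[M [Mr hM]]; apply/seteqP; split=> // x.
move=> /minkowski_diffP hx.
pose c : R := `|M| + 1; pose u : 'rV[R]_n := const_mx (c + 1).
have Ku : K u.
  by rewrite -[u](subrKC x); apply: hx => y; case.
have : `|u| <= c.
  by apply: hM Ku; rewrite (le_lt_trans (ler_norm _))// ltrDl.
have c0 : 0 <= c by rewrite addr_ge0.
move=> uc; have : `|u ord0 (Ordinal n0)| <= c.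
  apply: le_trans uc; rewrite [leRHS]/Num.norm/= mx_normrE.
  exact: (le_bigmax _ (fun ij => `|u ij.1 ij.2|) (ord0, Ordinal n0)).
by rewrite mxE ger0_norm ?addr_ge0// gerDl ler10.
Qed.

End Euclidean.

(* Main.v *)
Require Import Defs.
From HB Require Import structures.
From mathcomp Require Import all_boot all_order all_algebra.
From mathcomp Require Import all_classical all_reals all_analysis.
From mathcomp Require Import ring lra.

Import Order.TTheory GRing.Theory Num.Theory.
Import numFieldNormedType.Exports.

Local Open Scope classical_set_scope.
Local Open Scope card_scope.
Local Open Scope ring_scope.

Set Implicit Arguments.
Unset Strict Implicit.
Unset Printing Implicit Defensive.

(** Write [N_Z] for the set of [v] such that [x_i + v] lies in [K] for all [i] in
    [Z], and [C_Z] for the strong hull of the [x_i] with [i] in [Z].  As [K] is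
    generating, [N_Z + C_Z = K] for every nonempty [Z], so the faces of [N_Z] and
    [C_Z] in a given direction add up to a face of [K].

    A boundary point of the full hull [C] lies in [C_Z] for some [Z] of at most
    [n] indices.  Take a normal [e] at the point.  By Helly's theorem few
    indices suffice to bound [e] on [N_Z] by its maximum on the full
    intersection, and each index used costs one dimension of the face of [N_Z].
    The face of [C] in the direction [e] then contains a point [q] of [C_Z], and
    one recurses, inside that face, at the point where the ray issued from [q]
    and passing through the given point leaves it.

    For a general [p] in [C], the ray from a vertex through [p] ends at such a
    boundary point, which leaves [n + 1] vertices to consider.  If [p] is in none
    of the [n + 1] hulls of [n] vertices, let [u_i] separate [p] from the hull
    omitting [x_i].  Either some ray from [p] avoids all these hulls,
    contradicting the boundary case, or linear dependencies among the [u_i] and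
    among the [x_i - p] show that [p] is in the convex hull. *)

(** * Convex sets and convex combinations *)

Section Convexity.
Context {R : numDomainType} {V : lmodType R}.

Lemma convex_setP (A : set V) :
  @convex_set R V A <->
  forall a b t, A a -> A b -> 0 <= t -> t <= 1 -> A (t *: a + (1 - t) *: b).
Proof.
split=> [cA a b t Aa Ab t0 t1|cA a b t].
  have := cA a b (Itv01 t0 t1); rewrite !inE => /(_ Aa Ab).
  by [].
by rewrite !inE => Aa Ab; apply: cA.
Qed.

Lemma convex_setI (A B : set V) :
  @convex_set R V A -> @convex_set R V B -> @convex_set R V (A `&` B).
Proof.
move=> /convex_setP cA /convex_setP cB; apply/convex_setP.
by move=> a b t [Aa Ba] [Ab Bb] t0 t1; split; [exact: cA|exact: cB].
Qed.

Lemma convex_minkowski_diff (K T : set V) :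
  @convex_set R V K -> @convex_set R V (minkowski_diff K T).
Proof.
move=> /convex_setP cK; apply/convex_setP => a b t.
move=> /minkowski_diffP Ka /minkowski_diffP Kb t0 t1.
apply/minkowski_diffP => c Tc.
rewrite [X in K X](_ : _ = t *: (a + c) + (1 - t) *: (b + c)).
  by apply: cK => //; [exact: Ka|exact: Kb].
by rewrite !scalerDr addrACA -scalerDl subrKC scale1r.
Qed.

End Convexity.

(** By induction on the cardinality of [P]: an index of positive weight is split off and the
    remaining weights are divided by their sum [s], unless [s = 0]. *)
Lemma convex_combination {R : numFieldType} {V : lmodType R} (A : set V)
    (I : finType) (P : {set I}) (x : I -> V) (w : I -> R) :
  @convex_set R V A -> (forall i, i \in P -> A (x i)) ->
  (forall i, i \in P -> 0 <= w i) ->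
  \sum_(i in P) w i = 1 -> A (\sum_(i in P) w i *: x i).
Proof.
move=> /convex_setP cA.
have [k] := ubnP #|P|; elim: k P w => // k IH P w leP Ax w0 w1.
have [i0 i0P wi0] : exists2 i, i \in P & 0 < w i.
  apply/exists_inP; apply: contraT => /exists_inPn h.
  move: w1; rewrite big1 => [/eqP|i iP]; first by rewrite eq_sym oner_eq0.
  by apply/eqP; move: (h i iP); rewrite lt_def (w0 i iP) andbT negbK.
rewrite (big_setD1 i0)//=; move: w1; rewrite (big_setD1 i0)//= => w1.
set s := \sum_(i in P :\ i0) w i in w1.
have s0 : 0 <= s.
  by apply: sumr_ge0 => i; rewrite inE => /andP[_ iP]; exact: w0.
have [s00|sN0] := eqVneq s 0.
  rewrite big1 => [|i iP].
    by move: w1; rewrite s00 !addr0 => ->; rewrite scale1r; apply: Ax.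
  have : forall j, j \in P :\ i0 -> 0 <= w j.
    by move=> j; rewrite inE => /andP[_ jP]; exact: w0.
  move=> /psumr_eq0P/(_ s00)/(_ i iP) ->; exact: scale0r.
rewrite [X in _ + X](_ : _ = (1 - w i0) *: \sum_(i in P :\ i0) (w i / s) *: x i).
  apply: cA; [exact: Ax| |exact: ltW|by rewrite -w1 lerDl].
  apply: (IH _ (fun i => w i / s)).
  - by rewrite -ltnS (leq_trans _ leP)// ltnS (cardsD1 i0 P) i0P.
  - by move=> i; rewrite inE => /andP[_ iP]; exact: Ax.
  - by move=> i; rewrite inE => /andP[_ iP]; rewrite divr_ge0// w0.
  - by rewrite -mulr_suml mulfV.
have -> : 1 - w i0 = s by rewrite -w1 addrAC subrr add0r.
rewrite scaler_sumr; apply: eq_bigr => i _.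
by rewrite scalerA mulrCA mulfV ?mulr1.
Qed.

(** * The Euclidean inner product and nearest points *)

Section Dot.
Context {R : realType} {n : nat}.
Implicit Types (u v w : 'rV[R]_n) (A B C : set 'rV[R]_n).

Definition dot u v : R := (u *m v^T) 0 0.

Lemma dotE u v : dot u v = \sum_i u 0 i * v 0 i.
Proof. by rewrite /dot mxE; apply: eq_bigr => i _; rewrite mxE. Qed.

Lemma dotC u v : dot u v = dot v u.
Proof. by rewrite !dotE; apply: eq_bigr => i _; rewrite mulrC. Qed.

Lemma dotDr u v w : dot u (v + w) = dot u v + dot u w.
Proof. by rewrite /dot linearD mulmxDr mxE. Qed.

Lemma dotNr u v : dot u (- v) = - dot u v.
Proof. by rewrite /dot linearN mulmxN mxE. Qed.

Lemma dotZr u v a : dot u (a *: v) = a * dot u v.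
Proof. by rewrite /dot linearZ/= -scalemxAr mxE. Qed.

Lemma dotDl u v w : dot (v + w) u = dot v u + dot w u.
Proof. by rewrite dotC dotDr !(dotC u). Qed.

Lemma dotNl u v : dot (- v) u = - dot v u.
Proof. by rewrite dotC dotNr (dotC u). Qed.

Lemma dotZl u v a : dot (a *: v) u = a * dot v u.
Proof. by rewrite dotC dotZr (dotC u). Qed.

Lemma dot0l u : dot 0 u = 0.
Proof. by rewrite /dot mul0mx mxE. Qed.

Lemma dot0r u : dot u 0 = 0.
Proof. by rewrite dotC dot0l. Qed.

Definition dot_lin := (dotDr, dotDl, dotNr, dotNl, dotZr, dotZl).

Lemma dot_suml (I : finType) (P : pred I) (f : I -> 'rV[R]_n) u :
  dot (\sum_(i | P i) f i) u = \sum_(i | P i) dot (f i) u.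
Proof. by rewrite /dot mulmx_suml summxE. Qed.

Lemma dot_sumr (I : finType) (P : pred I) (f : I -> 'rV[R]_n) u :
  dot u (\sum_(i | P i) f i) = \sum_(i | P i) dot u (f i).
Proof. by rewrite dotC dot_suml; apply: eq_bigr => i _; rewrite dotC. Qed.

Lemma dot_ge0 u : 0 <= dot u u.
Proof. by rewrite dotE sumr_ge0// => i _; rewrite -expr2 sqr_ge0. Qed.

Lemma dot_eq0 u : (dot u u == 0) = (u == 0).
Proof.
apply/eqP/eqP => [|->]; last by rewrite dot0l.
rewrite dotE => /psumr_eq0P h; apply/rowP => i; rewrite mxE; apply/eqP.
by rewrite -(@sqrf_eq0 R) expr2 h// => j _; rewrite -expr2 sqr_ge0.
Qed.

Lemma dot_gt0 u : (0 < dot u u) = (u != 0).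
Proof. by rewrite lt_def dot_ge0 andbT dot_eq0. Qed.

Lemma dotDD_le u v : dot (u + v) (u + v) <= 2 * dot u u + 2 * dot v v.
Proof.
have := dot_ge0 (u - v); rewrite !dot_lin (dotC v u); lra.
Qed.

Lemma dot_continuous u : continuous (dot u).
Proof.
have -> : dot u = fun v => \sum_i u 0 i * v 0 i by apply/funext => v; exact: dotE.
apply: continuous_big; [exact: add_continuous|move=> i _ v].
have coordC : {for v, continuous (fun x : 'rV[R]_n => x 0 i)}.
  exact: coord_continuous.
exact: (continuousM (@cst_continuous _ _ (u 0 i) v) coordC).
Qed.

Lemma sqdist_continuous u : continuous (fun v => dot (v - u) (v - u)).
Proof.
rewrite (_ : (fun v => _) = fun v => \sum_i (v 0 i - u 0 i) * (v 0 i - u 0 i)).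
  apply: continuous_big; [exact: add_continuous|move=> i _ v].
  have coordC : {for v, continuous (fun x : 'rV[R]_n => x 0 i - u 0 i)}.
    apply: (@continuousB _ _ _ (fun x : 'rV[R]_n => x 0 i)).
      exact: coord_continuous.
    exact: cst_continuous.
  exact: (continuousM coordC coordC).
by apply/funext => v; rewrite dotE; apply: eq_bigr => i _; rewrite !mxE.
Qed.

Lemma compact_argmax C (f : 'rV[R]_n -> R) : C !=set0 -> compact C ->
  continuous f -> exists2 c, C c & forall c', C c' -> f c' <= f c.
Proof.
move=> C0 cC cf; have [c] := @compact_EVT_max _ R f C C0 cC (continuous_subspaceT cf).
by rewrite inE => Cc h; exists c => // c' /mem_set; exact: h.
Qed.

(** If the first inequality failed at [c'], a small move from [c] towards [c'] would come closer to
    [u]. *)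
Lemma nearest_point C u : C !=set0 -> compact C -> @convex_set R 'rV[R]_n C ->
  exists2 c, C c & (forall c', C c' -> dot (u - c) (c' - c) <= 0) /\
    (forall c', C c' -> dot (c - u) (c - u) <= dot (c' - u) (c' - u)).
Proof.
move=> C0 cC /convex_setP vC.
have [c Cc] := compact_argmax C0 cC (fun v => cvgN (@sqdist_continuous u v)).
move=> hm; have {}hm c' : C c' -> dot (c - u) (c - u) <= dot (c' - u) (c' - u).
  by move=> /hm; rewrite lerN2.
exists c => //; split=> // c' Cc'; rewrite leNgt; apply/negP => d0.
set d := dot _ _ in d0; set D := dot (c' - c) (c' - c).
have D0 : 0 <= D by exact: dot_ge0.
(* As [t * D <= d], this [t] changes the squared distance by [t ^+ 2 * D - 2 * t * d], which is at
   most [- t * d < 0]. *)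
pose t := d / (d + D).
have dD : 0 < d + D by rewrite ltr_pwDl.
have t0 : 0 < t by rewrite divr_gt0.
have t1 : t <= 1 by rewrite ler_pdivrMr// mul1r lerDl.
have tD : t * D <= d.
  by rewrite /t mulrAC ler_pdivrMr// ler_wpM2l ?(ltW d0)// lerDr ltW.
have := hm _ (vC _ _ t Cc' Cc (ltW t0) t1).
have -> : t *: c' + (1 - t) *: c - u = t *: (c' - c) - (u - c).
  by rewrite scalerBl scale1r scalerBr opprB [c - _]addrC !addrA.
rewrite -(opprB u c); move: @d @D d0 D0 @t dD t0 t1 tD.
move: (u - c) (c' - c) => p q d D d0 D0 t dD t0 t1 tD.
rewrite !dot_lin (dotC q p) -/d -/D.
nra.
Qed.

End Dot.

(** The weight left over, [1 - s], goes to [g], the [x i] being first averaged with weights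
    [w i / s]. *)
Lemma convex_star {R : numFieldType} {V : lmodType R} (A : set V)
    (I : finType) (P : {set I}) (x : I -> V) (w : I -> R) (g : V) :
  @convex_set R V A -> A g -> (forall i, i \in P -> A (x i)) ->
  (forall i, i \in P -> 0 <= w i) -> \sum_(i in P) w i <= 1 ->
  A (g + \sum_(i in P) w i *: (x i - g)).
Proof.
move=> cA Ag Ax w0 w1; set s := \sum_(i in P) w i in w1.
have s0 : 0 <= s by exact: sumr_ge0.
have [s00|sN0] := eqVneq s 0.
  rewrite big1 ?addr0// => i iP.
  by rewrite (psumr_eq0P w0 s00) ?scale0r.
rewrite [X in A X](_ : _ =
    s *: (\sum_(i in P) (w i / s) *: x i) + (1 - s) *: g); last first.
  rewrite scaler_sumr scalerBl scale1r addrCA; congr (_ + _).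
  rewrite scaler_suml -sumrB; apply: eq_bigr => i _.
  by rewrite scalerA mulrCA mulfV// mulr1 scalerBr.
move/convex_setP: (cA); apply => //; apply: convex_combination => //.
- by move=> i iP; rewrite divr_ge0// w0.
- by rewrite -mulr_suml mulfV.
Qed.

(** * Linear dependencies modulo a subspace *)

Section LinearAlgebra.
Context {F : fieldType} {n : nat}.

(** Multiplication by [cokermx E] passes to the quotient by [E], where the image of [D] has
    dimension [\rank D - \rank E], smaller than the number of vectors. *)
Lemma linear_dependence (I : finType) (Z : {set I}) (f : I -> 'rV[F]_n)
    (D E : 'M[F]_n) :
  (forall i, i \in Z -> (f i <= D)%MS) -> (E <= D)%MS ->
  (\rank D < #|Z| + \rank E)%N ->
  exists2 w : I -> F, (exists2 i, i \in Z & w i != 0) &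
    ((\sum_(i in Z) w i *: f i)%R <= E)%MS.
Proof.
move=> fD ED rD.
pose M := \matrix_(j < #|Z|) f (enum_val j).
have MD : (M <= D)%MS.
  by apply/row_subP => j; rewrite rowK fD// enum_valP.
have rN : (\rank (M *m cokermx E) < #|Z|)%N.
  rewrite (leq_ltn_trans (mxrankS (submxMr _ MD)))//.
  rewrite -(ltn_add2r (\rank E)) (leq_ltn_trans _ rD)//.
  rewrite -(mxrank_mul_ker D (cokermx E)) leq_add2l mxrankS// sub_capmx ED.
  by apply/sub_kermxP; exact: mulmx_coker.
have : ~~ row_free (M *m cokermx E) by rewrite /row_free neq_ltn rN.
rewrite -kermx_eq0 => /matrix0Pn[i [j kij]].
set r := row i (kermx (M *m cokermx E)).
have rj : r 0 j != 0 by rewrite mxE.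
have /sub_kermxP : (r <= kermx (M *m cokermx E))%MS by exact: row_sub.
rewrite mulmxA => /eqP; rewrite -submxE => rE.
exists (fun k => r 0 (enum_rank_in (enum_valP j) k)).
  by exists (enum_val j); [exact: enum_valP|rewrite enum_valK_in].
rewrite (_ : \sum_(_ in _) _ = r *m M)// mulmx_sum_row big_enum_val.
by apply: eq_bigr => k _; rewrite enum_valK_in rowK.
Qed.

End LinearAlgebra.

(** * Rays, relative interiors and a Helly-type dimension bound *)

Section ConvexGeometry.
Context {R : realType} {n : nat}.
Implicit Types (e : 'rV[R]_n) (A B C G : set 'rV[R]_n) (D E W : 'M[R]_n).

(** The exit parameter is the supremum of the [s] with [p + s *: r] in [C]: attained because [C] is
    closed, finite because [dot r] is bounded on [C]. *)
Lemma ray_exit C (p r : 'rV[R]_n) : compact C -> C p -> r != 0 ->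
  exists2 s : R, 0 <= s & C (p + s *: r) /\ forall t, s < t -> ~ C (p + t *: r).
Proof.
move=> cC Cp r0; pose S := [set s : R | C (p + s *: r)].
have clS : closed S.
  apply: (@preimage_closed _ _ (fun s : R => p + s *: r) C); last first.
    by apply: compact_closed => //; exact: norm_hausdorff.
  move=> s _; apply: cvgD; first exact: cvg_cst.
  exact: scalel_continuous.
have S0 : S 0 by rewrite /S/= scale0r addr0.
have [M _ hM] := compact_argmax (ex_intro _ p Cp) cC (@dot_continuous _ _ r).
have rr : 0 < dot r r by rewrite dot_gt0.
have ubS : ubound S ((dot r M - dot r p) / dot r r).
  move=> s /hM; rewrite !dot_lin => h.
  by rewrite ler_pdivlMr// lerBrDl.
have hS : has_sup S by split; [exists 0|exists ((dot r M - dot r p) / dot r r)].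
exists (sup S); first exact: sup_upper_bound.
split; first by have := closure_sup hS.1 hS.2 => /clS.
by move=> t + Ct; rewrite ltNge => /negP; apply; exact: sup_upper_bound.
Qed.

(** Algebraic interiority of [g] in [A] along the row space of [E]; as [eps] may depend on the
    direction, no topology on the affine hull is involved. *)
Definition radial_at A g E :=
  forall d : 'rV[R]_n, (d <= E)%MS ->
    exists2 eps : R, 0 < eps & forall t, 0 <= t <= eps -> A (g + t *: d).

(** Start from any point with [E = 0]. While some [c] in [A] lies outside [g + E], replace [g] by
    the midpoint of [g] and [c], and add [c - g] to [E]; the rank grows, so this stops. *)
Lemma relative_interior A : A !=set0 -> @convex_set R 'rV[R]_n A ->
  exists g E, [/\ A g, (forall c, A c -> (c - g <= E)%MS) & radial_at A g E].
Proof.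
move=> [a Aa] /convex_setP cA.
suff: forall k g E, (n - \rank E <= k)%N -> A g -> radial_at A g E ->
    exists g E, [/\ A g, (forall c, A c -> (c - g <= E)%MS) & radial_at A g E].
  move=> /(_ n a 0); apply; [by rewrite mxrank0 subn0|exact: Aa|].
  by move=> d; rewrite submx0 => /eqP ->; exists 1 => // t _; rewrite scaler0 addr0.
elim=> [|k IH] g E rE Ag intE; have [cE|/existsNP[c /not_implyP[Ac cE]]] :=
    pselect (forall c, A c -> (c - g <= E)%MS); try by exists g, E.
  by case: cE; rewrite submx_full// /row_full eqn_leq rank_leq_col -subn_eq0 -leqn0.
pose E' := (E + (c - g))%MS.
have EE' : (\rank E < \rank E')%N.
  apply: rank_ltmx; rewrite /ltmx addsmxSl addsmx_sub submx_refl/=.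
  exact/negP.
apply: (IH (2^-1 *: g + (1 - 2^-1) *: c) E').
- by rewrite -ltnS (leq_trans _ rE)// ltn_sub2l// (leq_trans EE')// rank_leq_col.
- by apply: cA => //; lra.
move=> d /sub_addsmxP[[u v] /= ->].
rewrite [v]mx11_scalar mul_scalar_mx.
have [e1 e10 he1] := intE (u *m E) (submxMl _ _).
move: (u *m E) (v 0 0) he1 => d1 b he1.
have b0 : 0 < 4 * (`|b| + 1) by rewrite mulr_gt0// ltr_wpDl.
exists (Num.min (4 * (`|b| + 1))^-1 (e1 / 4)).
  by rewrite lt_min invr_gt0 b0 divr_gt0.
move=> t /andP[t0]; rewrite le_min => /andP[tb te].
have tb' : `|t * b| <= 4^-1.
  rewrite normrM (ger0_norm t0) (le_trans (ler_wpM2r _ tb))//.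
  rewrite invfM -mulrA ler_piMr ?invr_ge0//.
  by rewrite mulrC ler_pdivrMr ?mul1r ?lerDl// ltr_wpDl.
move: tb'; rewrite ler_norml => /andP[tb1 tb2].
(* [be] is the weight of [c] when the displaced midpoint is written as a combination of [c] and a
   point [g + t' *: d1], with [t' = t / (1 - be)]. The bounds on [t] give [1 - be >= 4^-1], hence
   [t' <= 4 * t <= e1]. *)
pose be := 2^-1 + t * b.
have be1 : 4^-1 <= 1 - be by rewrite /be; lra.
have be2 : 0 <= be by rewrite /be; lra.
have be0 : 0 < 1 - be by apply: lt_le_trans be1.
rewrite [X in A X](_ : _ = be *: c + (1 - be) *: (g + (t / (1 - be)) *: d1)).
  apply: cA => //; last by rewrite -subr_ge0 ltW.
  apply: he1; rewrite divr_ge0 ?(ltW be0)//=.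
  rewrite ler_pdivrMr// (le_trans te)// ler_pM2l//.
rewrite [in RHS]scalerDr scalerA mulrCA mulfV ?gt_eqF// mulr1.
apply/rowP => i; rewrite !mxE /be; lra.
Qed.

(* Choosing for each [i] in [Z] a point of [G] beyond the hyperplane
   [dot e v = m] and outside [B i] only, a linear dependency modulo [E] between
   the vectors from [g] to these points yields, as in Radon's theorem, a point of
   all the [B i] beyond the hyperplane. *)
Lemma helly_dimension (I : finType) (B : I -> set 'rV[R]_n) (Z : {set I})
    G (D E : 'M[R]_n) e m g :
  (forall i, @convex_set R 'rV[R]_n (B i)) -> @convex_set R 'rV[R]_n G ->
  (forall a b, G a -> G b -> (a - b <= D)%MS) ->
  (forall v, G v -> (forall i, i \in Z -> B i v) -> dot e v <= m) ->
  (forall i, i \in Z -> exists v, [/\ G v,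
     (forall j, j \in Z -> j != i -> B j v) & m < dot e v]) ->
  G g -> (forall i, i \in Z -> B i g) -> dot e g = m ->
  radial_at [set v | [/\ G v, (forall i, i \in Z -> B i v) & dot e v = m]] g E ->
  (#|Z| + \rank E <= \rank D)%N.
Proof.
move=> cB cG GD lem hv Gg Bg eg intE.
have ED : (E <= D)%MS.
  apply/row_subP => i; have [t t0 ht] := intE (row i E) (row_sub _ _).
  have [|Gt _ _] := ht t; first by rewrite lexx ltW.
  have := GD _ _ Gt Gg; rewrite addrAC subrr add0r => /(scalemx_sub t^-1).
  by rewrite scalerA mulVf ?gt_eqF// scale1r.
(* From [g], every direction of [E] can be followed for a while inside the hyperplane, so [e] is
   orthogonal to [E]. *)
have eE d : (d <= E)%MS -> dot e d = 0.
  move=> /intE[t t0 ht]; have [|_ _] := ht t; first by rewrite lexx ltW.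
  rewrite !dot_lin eg => /eqP; rewrite -subr_eq0 addrAC subrr add0r mulf_eq0.
  by rewrite gt_eqF//= => /eqP.
rewrite leqNgt; apply/negP => lt.
have [v hvv] := all_sig_cond (0 : 'rV[R]_n) (fun i iZ => cid (hv i iZ)).
have fD i : i \in Z -> (v i - g <= D)%MS.
  by move=> /hvv[Gv _ _]; exact: GD.
have [w [i0 i0Z wi0] wE] := linear_dependence fD ED lt.
set d := \sum_(i in Z) _ in wE.
have ed := eE _ wE.
have c0 i : i \in Z -> 0 < dot e (v i - g).
  by move=> /hvv[_ _]; rewrite !dot_lin eg subr_gt0.
pose P := [set i in Z | 0 < w i]; pose N := [set i in Z | w i < 0].
have [i1 i1P] : exists i, i \in P.
  apply/existsP; apply: contraT => /existsPn nP.
  have w_le0 i : i \in Z -> w i <= 0.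
    by move=> iZ; have := nP i; rewrite inE iZ /= -leNgt.
  move: ed; rewrite /d dot_sumr => /eqP; rewrite -oppr_eq0 -sumrN => /eqP.
  move=> /psumr_eq0P => /(_ _ i0 i0Z) h.
  have /eqP : - dot e (w i0 *: (v i0 - g)) = 0.
    apply: h => i iZ; rewrite dotZr oppr_ge0.
    by rewrite mulr_le0_ge0 ?w_le0// ltW// c0.
  by rewrite oppr_eq0 dotZr mulf_eq0 (negbTE wi0) gt_eqF ?c0.
pose sP := \sum_(i in P) w i; pose sN := \sum_(i in N) - w i.
have sP0 : 0 <= sP by apply: sumr_ge0 => i; rewrite inE => /andP[_ /ltW].
have sN0 : 0 <= sN.
  by apply: sumr_ge0 => i; rewrite inE => /andP[_ /ltW]; rewrite oppr_ge0.
have [eta0 eta00 heta0] := intE d wE.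
pose eta := Num.min eta0 (sP + 1)^-1.
have sP1 : 0 < sP + 1 by rewrite ltr_wpDl.
have eta_gt0 : 0 < eta by rewrite lt_min eta00 invr_gt0.
have [|Gg1 Bg1 eg1] := heta0 eta; first by rewrite ltW//= ge_min lexx.
have den : 0 < 1 + eta * sN by rewrite ltr_pwDl// mulr_ge0// ltW.
(* [eps] solves [eps * (1 + eta * sN) = eta], which makes the two expressions of [z] below agree;
   the cap [(sP + 1)^-1] on [eta] ensures [eps * sP <= 1]. *)
pose eps := eta / (1 + eta * sN).
have eps0 : 0 < eps by rewrite divr_gt0.
have epsP : eps * sP <= 1.
  have : eps <= (sP + 1)^-1.
    rewrite /eps ler_pdivrMr// (le_trans (_ : _ <= (sP + 1)^-1))//.
      by rewrite ge_min lexx orbT.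
    by rewrite ler_peMr ?invr_ge0 ?(ltW sP1)// lerDl mulr_ge0// ltW.
  move=> /(ler_wpM2r sP0) /le_trans; apply.
  by rewrite mulrC ler_pdivrMr// mul1r lerDl.
have epsN : eps * sN <= 1.
  by rewrite /eps mulrAC ler_pdivrMr// mul1r lerDr.
pose z := g + \sum_(i in P) (eps * w i) *: (v i - g).
have dE : d = \sum_(i in P) w i *: (v i - g) - \sum_(i in N) (- w i) *: (v i - g).
  rewrite /d (bigID (fun i => 0 < w i))/= -sumrN.
  congr (_ + _); first by apply: eq_bigl => i; rewrite inE.
  rewrite (bigID (fun i => w i == 0))/= big1 ?add0r.
    apply: eq_big => [i|i _]; last by rewrite scaleNr opprK.
    by rewrite inE -andbA; congr (_ && _); rewrite -leNgt lt_neqAle andbC.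
  by move=> i /andP[_ /eqP ->]; rewrite scale0r.
have zE : z = (g + eta *: d) +
    \sum_(i in N) (eps * - w i) *: (v i - (g + eta *: d)).
  under [in RHS]eq_bigr do rewrite opprD addrA scalerBr.
  rewrite sumrB -scaler_suml -mulr_sumr -/sN.
  under eq_bigr do rewrite -scalerA; rewrite -scaler_sumr.
  rewrite /z; under eq_bigr do rewrite -scalerA; rewrite -scaler_sumr.
  have -> : \sum_(i in P) w i *: (v i - g) =
      d + \sum_(i in N) (- w i) *: (v i - g) by rewrite dE subrK.
  rewrite scalerDr; set y := \sum_(i in N) _ *: (v i - g).
  have -> : eps *: d = eta *: d - (eps * sN) *: (eta *: d).
    rewrite scalerA -scalerBl; congr (_ *: _).
    by rewrite /eps; field; rewrite gt_eqF.
  by rewrite -!addrA; congr (_ + (_ + _)); rewrite addrC.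
have hP i : i \in P -> i \in Z by rewrite inE => /andP[].
have hN i : i \in N -> i \in Z by rewrite inE => /andP[].
have wP i : i \in P -> 0 <= eps * w i.
  by rewrite inE => /andP[_ /ltW w0]; rewrite mulr_ge0// ltW.
have Gz : G z.
  apply: convex_star => //; first by move=> i /hP/hvv[].
  by rewrite -mulr_sumr.
(* For [j] in [P], the expression of [z] through [N] avoids [v j]; otherwise the one through [P]
   does. Either way only points of [B j] are combined. *)
have Bz j : j \in Z -> B j z.
  move=> jZ; have [jP|jP] := boolP (j \in P).
    rewrite zE; apply: convex_star => //; first exact: Bg1.
    - move=> i iN; have [_ h _] := hvv i (hN i iN); apply: h => //.
      apply: contraTneq jP => ->; move: iN; rewrite !inE => /andP[-> /ltW].
      by rewrite -leNgt.
    - by move=> i; rewrite inE => /andP[_ /ltW w0]; rewrite mulr_ge0 ?oppr_ge0// ltW.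
    - by rewrite -mulr_sumr.
  apply: convex_star => //; first exact: Bg.
  - move=> i iP; have [_ h _] := hvv i (hP i iP); apply: h => //.
    by apply: contraNneq jP => ->.
  - by rewrite -mulr_sumr.
have := lem z Gz Bz; rewrite leNgt => /negP; apply.
rewrite /z dotDr eg ltrDl dot_sumr (bigD1 i1)//=; apply: ltr_pwDl.
  rewrite dotZr mulr_gt0 ?c0 ?hP// mulr_gt0//.
  by move: i1P; rewrite inE => /andP[].
apply: sumr_ge0 => i /andP[iP _].
by rewrite dotZr mulr_ge0// ?wP// ltW// c0// hP.
Qed.

End ConvexGeometry.

(** * Strong hulls of finite families and their faces *)

Section StrongHull.
Context {R : realType} {n : nat} (K : set 'rV[R]_n) (I : finType).
Context (x : I -> 'rV[R]_n).
Implicit Types (Y Z : {set I}) (e p r : 'rV[R]_n) (D W : 'M[R]_n).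

(** [shifts Z] and [hull Z] are the [N_Z] and [C_Z] of the introduction. Indexing the points allows
    repetitions, used when a family is padded to [n + 1] points. *)
Definition shifts Z : set 'rV[R]_n := [set v | forall i, i \in Z -> K (x i + v)].

Definition hull Z : set 'rV[R]_n := strong_hull K [set x i | i in [set` Z]].

Lemma minkowski_diff_image Z :
  minkowski_diff K [set x i | i in [set` Z]] = shifts Z.
Proof.
apply/seteqP; split=> [v /minkowski_diffP h i iZ|v h].
  by rewrite addrC; apply: h; exists i.
by apply/minkowski_diffP => _ [i iZ <-]; rewrite addrC; exact: h.
Qed.

Lemma hullP Z c : hull Z c <-> forall v, shifts Z v -> K (c + v).
Proof. by rewrite /hull/strong_hull minkowski_diff_image; exact: minkowski_diffP. Qed.

Lemma shifts_sub Y Z : Y \subset Z -> shifts Z `<=` shifts Y.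
Proof. by move=> /fintype.subsetP YZ v vZ i /YZ/vZ. Qed.

Lemma hull_sub Y Z : Y \subset Z -> hull Y `<=` hull Z.
Proof. by move=> YZ c /hullP h; apply/hullP => v /(shifts_sub YZ)/h. Qed.

Lemma mem_hull i Z : i \in Z -> hull Z (x i).
Proof. by move=> iZ; apply/hullP => v; apply. Qed.

Context (genK : generating_set K).

Let compactK : compact K. Proof. by case: genK.1. Qed.

Let convexK : @convex_set R 'rV[R]_n K. Proof. by case: genK.1. Qed.

Lemma compact_translate v : compact [set c | K (c + v)].
Proof.
rewrite (_ : [set _ | _] = [set k - v | k in K]).
  apply: continuous_compact => //; apply: continuous_subspaceT => k.
  apply: (@continuousB _ _ _ id (cst v)); first by [].
  exact: cst_continuous.
apply/seteqP; split=> [c Kc|_ [k Kk <-]]; last by rewrite /= subrK.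
by exists (c + v) => //; rewrite addrK.
Qed.

Lemma closed_translate v : closed [set c | K (c + v)].
Proof. by apply: compact_closed; [exact: norm_hausdorff|exact: compact_translate]. Qed.

Lemma closed_shifts Z : closed (shifts Z).
Proof.
rewrite (_ : shifts Z = \bigcap_(i in [set` Z]) [set c | K (c + x i)]).
  by apply: closed_bigI => i _; exact: closed_translate.
by apply/seteqP; split=> v h i /h; rewrite /= addrC.
Qed.

Lemma compact_shifts i Z : i \in Z -> compact (shifts Z).
Proof.
move=> iZ; apply: (subclosed_compact (@closed_shifts Z) (@compact_translate (x i))).
by move=> v /(_ i iZ); rewrite /= addrC.
Qed.

Lemma closed_hull Z : closed (hull Z).
Proof.
rewrite (_ : hull Z = \bigcap_(v in shifts Z) [set c | K (c + v)]).
  by apply: closed_bigI => v _; exact: closed_translate.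
by apply/seteqP; split=> c; [move/hullP|move=> h; apply/hullP].
Qed.

Lemma convex_shift i : @convex_set R 'rV[R]_n [set v | K (x i + v)].
Proof.
apply/convex_setP => a b t Ka Kb t0 t1 /=.
rewrite [X in K X](_ : _ = t *: (x i + a) + (1 - t) *: (x i + b)).
  by move/convex_setP : convexK; apply.
by rewrite !scalerDr addrACA -scalerDl subrKC scale1r.
Qed.

Lemma convex_shifts Z : @convex_set R 'rV[R]_n (shifts Z).
Proof. by rewrite -minkowski_diff_image; exact: convex_minkowski_diff. Qed.

Lemma convex_hullK Z : @convex_set R 'rV[R]_n (hull Z).
Proof. exact: convex_minkowski_diff. Qed.

(** The complementary summand [T'] of [K] lies in [hull Z], since adding one of its points to any
    [v] in [shifts Z] gives a point of [K]. *)
Lemma generating_sum i Z k : i \in Z -> shifts Z !=set0 -> K k ->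
  exists g c, [/\ shifts Z g, hull Z c & k = g + c].
Proof.
move=> iZ Z0 Kk; have [_ /(_ [set x i | i in [set` Z]])] := genK.
rewrite minkowski_diff_image => -[|//|T' _ sumK]; first by exists (x i), i.
have := Kk; rewrite -{1}sumK => -[g gZ [c T'c <-]]; exists g, c; split=> //.
apply/hullP => v vZ; rewrite addrC -sumK; exists v => //.
by exists c.
Qed.

Context (shiftsT : shifts finset.setT !=set0).

Lemma shifts_neq0 Z : shifts Z !=set0.
Proof. by have [v vT] := shiftsT; exists v; exact: shifts_sub vT. Qed.

Lemma compact_hull Z : compact (hull Z).
Proof.
have [v vZ] := shifts_neq0 Z.
apply: (subclosed_compact (@closed_hull Z) (@compact_translate v)).
by move=> c /hullP; exact.
Qed.

(* [Gam] and [Psi] are the intersections of hyperplanes that cut out the faces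
   of the [shifts Z] and of the [hull Z], for [Z] containing [Y], determined by
   one and the same sequence of directions. *)
Record face_data Y (Gam Psi : set 'rV[R]_n) D : Prop := FaceData {
  closed_Gam : closed Gam;
  convex_Gam : @convex_set R 'rV[R]_n Gam;
  closed_Psi : closed Psi;
  convex_Psi : @convex_set R 'rV[R]_n Psi;
  Gam_neq0 : (Gam `&` shifts finset.setT) !=set0;
  face_rank : (#|Y| + \rank D <= n)%N;
  face_span : forall a b, (shifts Y `&` Gam) a -> (shifts Y `&` Gam) b ->
    (a - b <= D)%MS;
  face_sum : forall Z g c, Y \subset Z -> Z != finset.set0 ->
    (Gam `&` shifts finset.setT) g -> (Psi `&` hull finset.setT) c ->
    exists g' c', [/\ (Gam `&` shifts Z) g', (Psi `&` hull Z) c' & g + c = g' + c'];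
  face_top : Y = finset.set0 -> Gam = setT
}.

Lemma closed_hyperplane e m : closed [set v | dot e v = m].
Proof.
apply: (@preimage_closed _ _ (dot e) [set y | y = m]); last exact: closed_eq.
by move=> v _; exact: dot_continuous.
Qed.

Lemma convex_hyperplane e m : @convex_set R 'rV[R]_n [set v | dot e v = m].
Proof.
apply/convex_setP => a b t /= ea eb _ _.
by rewrite !dot_lin ea eb -mulrDl subrKC mul1r.
Qed.

(** [Y'] is [Y] together with a minimal set [Z0] of indices whose constraints still bound [dot e] on
    the face of [shifts Y] by its maximum [m] over the full intersection. Minimality is what
    [helly_dimension] requires; it pays for the new indices with dimensions of the face. *)
Lemma face_step (i0 : I) Y Gam Psi D e p : face_data Y Gam Psi D ->
  (Psi `&` hull finset.setT) p ->
  (forall c, (Psi `&` hull finset.setT) c -> dot e c <= dot e p) -> e != 0 ->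
  exists Y' Gam' D', [/\ Y \subset Y', Y' != finset.set0 &
    face_data Y' Gam' (Psi `&` [set c | dot e c = dot e p]) D'].
Proof.
move=> [clG cvG clP cvP G0 rkD spD sumD topD] Pp supp e0.
have cptG : compact (Gam `&` shifts finset.setT).
  rewrite setIC; apply: compact_closedI => //.
  by apply: (@compact_shifts i0); rewrite finset.inE.
have [gs [Ggs Tgs] gsmax] := compact_argmax G0 cptG (@dot_continuous _ _ e).
set m := dot e gs in gsmax.
pose q Z := `[< forall v, Gam v -> shifts Y v -> shifts Z v -> dot e v <= m >].
have qT : q finset.setT.
  by apply/asboolP => v Gv _ Tv; exact: gsmax.
have [Z0 /minsetP[/asboolP qZ0 minZ0] _] := minset_exists qT.
pose G := shifts Y `&` Gam.
have cvxG : @convex_set R 'rV[R]_n G by apply: convex_setI => //; exact: convex_shifts.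
pose G' := [set v | [/\ G v, (forall i, i \in Z0 -> K (x i + v)) & dot e v = m]].
have G'gs : G' gs.
  split=> //; first by split=> //; exact: shifts_sub Tgs.
  by move=> i _; apply: Tgs; rewrite finset.inE.
have cvG' : @convex_set R 'rV[R]_n G'.
  rewrite (_ : G' = (G `&` shifts Z0) `&` [set v | dot e v = m]).
    apply: convex_setI; last exact: convex_hyperplane.
    by apply: convex_setI => //; exact: convex_shifts.
  by apply/seteqP; split=> [v []|v [[]]].
have [g [E [[Gg Bg eg] G'E intE]]] := relative_interior (ex_intro _ _ G'gs) cvG'.
have rkE : (#|Z0| + \rank E <= \rank D)%N.
  apply: (helly_dimension convex_shift cvxG spD) intE => //.
    by move=> v [Yv Gv] Zv; exact: qZ0.
  move=> i iZ0.
  have : ~~ q (Z0 :\ i)%SET.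
    apply/negP => /minZ0; rewrite subsetDl => /(_ isT) /setP/(_ i).
    by rewrite !finset.inE eqxx iZ0.
  move=> /asboolPn/existsNP[v /not_implyP[Gv /not_implyP[Yv /not_implyP[Zv /negP]]]].
  rewrite -ltNge => mv; exists v; split=> // j jZ ji.
  by apply: Zv; rewrite !finset.inE ji.
(* Were both empty, [Gam] would be the whole space by [topD], and [dot e], with [e] nonzero, is
   unbounded there. *)
have YZ0 : (Y :|: Z0)%SET != finset.set0.
  apply/eqP => /eqP; rewrite finset.setU_eq0 => /andP[/eqP Y0 /eqP Z00].
  suff : m + 1 <= m by rewrite leNgt ltrDl ltr01.
  have -> : m + 1 = dot e (((m + 1) / dot e e) *: e).
    by rewrite dotZr divfK// gt_eqF// dot_gt0.
  by apply: qZ0; rewrite ?topD// ?Z00 ?Y0 => i; rewrite finset.inE.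
exists (Y :|: Z0)%SET, (Gam `&` [set v | dot e v = m]), E.
split => //; first exact: finset.subsetUl.
split.
- by apply: closedI => //; exact: closed_hyperplane.
- by apply: convex_setI => //; exact: convex_hyperplane.
- by apply: closedI => //; exact: closed_hyperplane.
- by apply: convex_setI => //; exact: convex_hyperplane.
- by exists gs.
- rewrite (leq_trans _ rkD)// (leq_trans (leq_add (leq_card_setU _ _) (leqnn _)))//.
  by rewrite -addnA leq_add2l.
- have GG' v : (shifts (Y :|: Z0)%SET `&` (Gam `&` [set v | dot e v = m])) v -> G' v.
    move=> [Uv [Gv ev]]; split=> //.
      by split=> //; apply: shifts_sub Uv; exact: finset.subsetUl.
    by apply: shifts_sub Uv; exact: finset.subsetUr.
  move=> a b /GG'/G'E aE /GG'/G'E bE.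
  have -> : a - b = (a - g) - (b - g) by rewrite opprB addrA subrK.
  by rewrite addmx_sub// eqmx_opp.
- move=> Z g1 c1 UZ Z0' [[Gg1 eg1] Tg1] [[Pc1 ec1] Tc1].
  have YZ : Y \subset Z by exact: fintype.subset_trans (finset.subsetUl _ _) UZ.
  have Z0Z : Z0 \subset Z by exact: fintype.subset_trans (finset.subsetUr _ _) UZ.
  have [g2 [c2 [[Gg2 Zg2] [Pc2 Zc2] gc]]] :=
    sumD Z g1 c1 YZ Z0' (conj Gg1 Tg1) (conj Pc1 Tc1).
  have le1 : dot e g2 <= m.
    by apply: qZ0 => //; [exact: shifts_sub Zg2|exact: shifts_sub Zg2].
  have le2 : dot e c2 <= dot e p.
    by apply: supp; split=> //; apply: hull_sub Zc2; exact: finset.subsetT.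
  (* The terms on the right are at most [m] and [dot e p], the values of those on the left, so both
     bounds are equalities. *)
  have : dot e g1 + dot e c1 = dot e g2 + dot e c2 by rewrite -!dotDr gc.
  move: eg1 ec1 => /= -> -> eq.
  by exists g2, c2; split=> //; split=> //; split=> //=; lra.
- by move=> Y0; rewrite Y0 eqxx in YZ0.
Qed.

(* The normals are taken at the points nearest to points of the ray outside the
   face, which approach [p]; as the hulls are closed, covering these nearest
   points is enough. *)
Lemma boundary_cover_face (i0 : I) k W Y Gam Psi D p r :
  (\rank W <= k)%N -> face_data Y Gam Psi D ->
  (forall a b, Psi a -> Psi b -> (a - b <= W)%MS) ->
  (Psi `&` hull finset.setT) p -> (r <= W)%MS ->
  (forall s, 0 < s -> ~ (Psi `&` hull finset.setT) (p + s *: r)) ->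
  exists Z, [/\ Y \subset Z, (#|Z| <= n)%N & hull Z p].
Proof.
elim: k W Y Gam Psi D p r => [|k IH] W Y Gam Psi D p r rkW FD PW Pp rW exitp.
  (* In rank 0 the direction [r] vanishes, and the ray cannot leave the face. *)
  move: rkW rW; rewrite leqn0 mxrank_eq0 => /eqP ->; rewrite submx0 => /eqP r0.
  by case: (exitp 1 ltr01); rewrite r0 scaler0 addr0.
pose C := Psi `&` hull finset.setT.
have cptC : compact C.
  rewrite /C setIC; apply: compact_closedI; first exact: compact_hull.
  exact: closed_Psi FD.
have cvxC : @convex_set R 'rV[R]_n C.
  by apply: convex_setI; [exact: convex_Psi FD|exact: convex_hullK].
apply: contrapT => nZ.
pose A := [set Z : {set I} | Y \subset Z /\ (#|Z| <= n)%N].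
pose F := \bigcup_(Z in A) hull Z.
have Fp : ~ F p by move=> [Z [YZ Zn] Zp]; apply: nZ; exists Z.
have cptF : compact F.
  apply: (@subclosed_compact _ _ (hull finset.setT)); last first.
  - by move=> c [Z _]; apply: hull_sub; exact: finset.subsetT.
  - exact: compact_hull.
  - by apply: closed_bigcup => [|Z _]; [exact: finite_finset|exact: closed_hull].
have [del del0 hdel] : exists2 del, 0 < del &
    forall c, F c -> del <= dot (c - p) (c - p).
  have [[c Fc]|F0] := pselect (F !=set0); last first.
    by exists 1 => // c Fc; case: F0; exists c.
  have [c' Fc' hc'] := compact_argmax (ex_intro _ c Fc) cptF
    (fun v => cvgN (@sqdist_continuous _ _ p v)).
  exists (dot (c' - p) (c' - p)).
    by rewrite dot_gt0 subr_eq0; apply/eqP => c'p; apply: Fp; rewrite -c'p.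
  by move=> c'' /hc'; rewrite lerN2.
pose rr := dot r r.
have rr0 : 0 <= rr by exact: dot_ge0.
(* The point [c] nearest to [y = p + s *: r] is no farther from [y] than [p] is, so its squared
   distance to [p] is at most [4 * s * s * rr]. This [s] makes that less than [del], so [c] cannot
   lie in [F]. *)
pose s := del / (4 * rr + del).
have den0 : 0 < 4 * rr + del by rewrite ltr_wpDl// mulr_ge0.
have s0 : 0 < s by rewrite divr_gt0.
have s1 : s <= 1 by rewrite ler_pdivrMr// mul1r lerDr mulr_ge0.
have srr : 4 * s * s * rr < del.
  have : s * (4 * rr + del) = del by rewrite /s divfK// gt_eqF.
  have : 0 < s * del by rewrite mulr_gt0.
  have : 0 <= (1 - s) * (s * rr) by rewrite mulr_ge0 ?subr_ge0// mulr_ge0// ltW.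
  nra.
have [c Cc [supc nearc]] := nearest_point (p + s *: r) (ex_intro _ p Pp) cptC cvxC.
set y := p + s *: r in supc nearc.
pose e := y - c.
have e0 : e != 0.
  by rewrite subr_eq0; apply/eqP => yc; apply: (exitp s s0); rewrite -/y yc.
have eW : (e <= W)%MS.
  rewrite /e /y addrAC addmx_sub ?scalemx_sub// PW//; [exact: Pp.1|exact: Cc.1].
have supp c' : C c' -> dot e c' <= dot e c.
  by move=> /supc; rewrite -/e dotDr dotNr subr_le0.
have [Y' [Gam' [D' [YY' Y'0 FD']]]] := face_step i0 FD Cc supp e0.
set Psi' := Psi `&` _ in FD'.
have Cc' : (Psi' `&` hull finset.setT) c by case: Cc.
suff [Z [Y'Z Zn Zc]] : exists Z, [/\ Y' \subset Z, (#|Z| <= n)%N & hull Z c].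
  have /hdel : F c by exists Z => //; split=> //; exact: fintype.subset_trans Y'Z.
  rewrite leNgt => /negP; apply.
  have -> : c - p = (c - y) + (y - p) by rewrite addrA subrK.
  have ypE : y - p = s *: r by rewrite /y addrAC subrr add0r.
  have := nearc p Pp; have := dotDD_le (c - y) (y - p).
  rewrite -[p - y]opprB ypE !dot_lin -/rr.
  nra.
(* Decomposing over [Y'] a sum of points of the two new faces yields a point of the face that
   already lies in [hull Y']. *)
have [q [Pq Y'q]] : (Psi' `&` hull Y') !=set0.
  have [gs Ggs] := Gam_neq0 FD'.
  have [_ [q [_ Pq _]]] := face_sum FD' (subxx _) Y'0 Ggs Cc'.
  by exists q.
have [cq|cq] := eqVneq c q.
  exists Y'; split; rewrite ?cq//.
  by apply: leq_trans (face_rank FD'); exact: leq_addr.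
have cptC' : compact (Psi' `&` hull finset.setT).
  by rewrite setIC; apply: compact_closedI; [exact: compact_hull|exact: closed_Psi FD'].
have cq0 : c - q != 0 by rewrite subr_eq0.
have [t t0 [Ct exitt]] := ray_exit cptC' Cc' cq0.
have P'W a b : Psi' a -> Psi' b -> (a - b <= W :&: kermx e^T)%MS.
  move=> [Pa ea] [Pb eb]; rewrite sub_capmx PW//=; apply/sub_kermxP.
  apply/matrixP => i j; rewrite !ord1 [in RHS]mxE -[LHS]/(dot (a - b) e).
  by rewrite dotC dotDr dotNr ea eb subrr.
(* The recursion is on the rank of [W], which drops because [e] is a nonzero vector of [W] while the
   new face is orthogonal to [e]. A set [Z] found for the exit point contains [Y'], so [hull Z]
   contains [q] as well, and [c] by convexity. *)
have [| | |Z [Y'Z Zn Zc']] := IH (W :&: kermx e^T)%MS _ _ _ _ _ (c - q) _ FD' P'W Ct.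
- rewrite -ltnS (leq_trans _ rkW)//; apply: rank_ltmx.
  rewrite /ltmx capmxSl/= sub_capmx submx_refl/=; apply/negP => WE.
  move: e0; rewrite -dot_eq0 => /eqP; apply.
  by have /sub_kermxP := submx_trans eW WE; rewrite /dot => ->; rewrite mxE.
- apply: P'W => //; exact: Cc'.1.
- move=> u u0; rewrite -addrA -scalerDl; apply: exitt.
  by rewrite ltrDl.
exists Z; split=> //.
have t1 : 0 < 1 + t by rewrite ltr_pwDl.
rewrite (_ : c = (1 + t)^-1 *: (c + t *: (c - q)) + (1 - (1 + t)^-1) *: q).
  move/convex_setP: (@convex_hullK Z); apply => //.
  - exact: hull_sub Y'q.
  - by rewrite invr_ge0 ltW.
  - by rewrite invf_le1// lerDl.
by apply/rowP => i; rewrite !mxE; field; rewrite gt_eqF.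
Qed.

(** The recursion starts from the improper faces, with [Y] empty and no hyperplane; there [face_sum]
    is the generating property of [K]. *)
Lemma boundary_cover (i0 : I) p r : hull finset.setT p ->
  (forall s, 0 < s -> ~ hull finset.setT (p + s *: r)) ->
  exists2 Z : {set I}, (#|Z| <= n)%N & hull Z p.
Proof.
move=> Tp exitp.
have FD : face_data finset.set0 setT setT 1%:M.
  split.
  - exact: closedT.
  - by apply/convex_setP.
  - exact: closedT.
  - by apply/convex_setP.
  - by rewrite setTI.
  - by rewrite cards0 mxrank1.
  - by move=> a b _ _; exact: submx1.
  - move=> Z g c _ /finset.set0Pn[i iZ] [_ Tg] [_ /hullP Tc].
    have [g' [c' [Zg' Zc' gc]]] := generating_sum iZ (shifts_neq0 Z) (Tc _ Tg).
    by exists g', c'; split=> //; rewrite addrC.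
  - by [].
have [| | |Z [_ Zn Zp]] :=
    @boundary_cover_face i0 n 1%:M _ _ _ _ p r _ FD
      (fun a b _ _ => submx1 _) _ (submx1 _).
- by rewrite mxrank1.
- by split.
- by move=> s s0 [_]; exact: exitp.
- by exists Z.
Qed.

Lemma ray_cover (i0 : I) p r : hull finset.setT p -> r != 0 ->
  exists2 t, 0 <= t &
    exists2 Z : {set I}, (#|Z| <= n)%N & hull Z (p + t *: r).
Proof.
move=> Tp r0; have [t t0 [Tt exitt]] := ray_exit (@compact_hull finset.setT) Tp r0.
exists t => //; apply: (@boundary_cover i0 _ r) => // s s0.
by rewrite -addrA -scalerDl; apply: exitt; rewrite ltrDl.
Qed.

Lemma cover_with_vertex (i0 : I) p : hull finset.setT p ->
  exists2 Z : {set I}, (#|Z| <= n)%N & hull (i0 |: Z) p.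
Proof.
move=> Tp; have xZ Z : hull (i0 |: Z) (x i0).
  by apply: mem_hull; rewrite finset.setU11.
have [->|pN] := eqVneq p (x i0); first by exists finset.set0; rewrite ?cards0.
have r0 : p - x i0 != 0 by rewrite subr_eq0.
have [t t0 [Z Zn Zt]] := ray_cover i0 Tp r0; exists Z => //.
have t1 : 0 < 1 + t by rewrite ltr_pwDl.
rewrite (_ : p = (1 + t)^-1 *: (p + t *: (p - x i0)) + (1 - (1 + t)^-1) *: x i0).
  move/convex_setP: (@convex_hullK (i0 |: Z)); apply => //.
  - by apply: hull_sub Zt; exact: finset.subsetUr.
  - by rewrite invr_ge0 ltW.
  - by rewrite invf_le1// lerDl.
by apply/rowP => i; rewrite !mxE; field; rewrite gt_eqF.
Qed.

End StrongHull.

(** * Theorems of the alternative for finitely many vectors *)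

Section Simplex.
Context {R : realType} {n : nat}.

(** Let [c] be the point nearest to 0 in the convex hull of the [u i]. If [c] is nonzero it serves
    as [r]; if [c = 0], its barycentric coordinates give the dependency. *)
Lemma gordan N (u : 'I_N -> 'rV[R]_n) : (0 < N)%N ->
  (exists r, forall i, 0 < dot (u i) r) \/
  (exists l : 'I_N -> R, [/\ forall i, 0 <= l i, exists i, l i != 0 &
     \sum_i l i *: u i = 0]).
Proof.
move=> N0; pose Simplex := [set l : 'rV[R]_N |
  (forall i, l ord0 i \in `[0, 1]%R) /\ dot (const_mx 1) l = 1].
have sumE l : dot (const_mx 1) l = \sum_i l 0 i :> R.
  by rewrite dotE; apply: eq_bigr => i _; rewrite mxE mul1r.
pose M := \matrix_(i < N) u i.
pose C := [set l *m M | l in Simplex].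
have Clin (l : 'rV[R]_N) : l *m M = \sum_i l 0 i *: u i.
  by rewrite mulmx_sum_row; apply: eq_bigr => i _; rewrite rowK.
have cptC : compact C.
  apply: continuous_compact.
    apply: continuous_subspaceT.
    rewrite (_ : (fun l => _) = fun l : 'rV[R]_N => \sum_i l 0 i *: u i).
      2: by apply/funext => l; exact: Clin.
    apply: continuous_big; [exact: add_continuous|move=> i _ l].
    apply: (@continuous_comp _ _ _ (fun l : 'rV[R]_N => l 0 i) (fun t : R => t *: u i)).
      exact: coord_continuous.
    exact: scalel_continuous.
  have cube : compact [set l : 'rV[R]_N | forall i, l ord0 i \in `[0, 1]%R].
    apply: (@rV_compact _ _ (fun=> `[0 : R, 1]%classic)).
    by move=> _; exact: segment_compact.
  apply: (compact_closedI cube).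
  exact: closed_hyperplane.
have cvxC : @convex_set R 'rV[R]_n C.
  apply/convex_setP => _ _ t [a [a01 as1] <-] [b [b01 bs1] <-] t0 t1.
  exists (t *: a + (1 - t) *: b); last by rewrite mulmxDl -!scalemxAl.
  split; last by rewrite dotDr !dotZr as1 bs1 !mulr1 subrKC.
  move=> i; move: (a01 i) (b01 i); rewrite /= !in_itv/= !mxE.
  move=> /andP[a0 a1] /andP[b0 b1].
  by apply/andP; split; nra.
have Cu i : C (u i).
  exists (delta_mx 0 i); last by rewrite -rowE rowK.
  split=> [j|].
    by rewrite /= in_itv/= mxE eqxx/=; case: eqP; rewrite ?lexx ?ler01.
  rewrite sumE (bigD1 i)//= mxE !eqxx big1 ?addr0// => j ji.
  by rewrite mxE (negbTE ji) andbF.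
have [c Cc [sup _]] := nearest_point 0 (ex_intro _ _ (Cu (Ordinal N0))) cptC cvxC.
have [c0|cN0] := eqVneq c 0.
  right; move: Cc => [l [l01 ls1] lc].
  exists (l 0); split.
  - by move=> i; have := l01 i; rewrite /= in_itv/= => /andP[].
  - apply/existsP; apply: contraT => /existsPn h.
    have : dot (const_mx 1) l = 0.
      by rewrite sumE big1// => i _; apply/eqP; rewrite -[_ == _]negbK h.
    by rewrite ls1 => /eqP; rewrite oner_eq0.
  - by rewrite -Clin lc c0.
left; exists c => i; have := sup _ (Cu i).
rewrite sub0r !dot_lin dotC.
have : 0 < dot c c by rewrite dot_gt0.
lra.
Qed.

(* Let [l] and [w] be the coefficients of linear dependencies among the [u i] and
   the [y i], with [l > 0].  If the signs of [w] were mixed, the vector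
   [\sum_(w j > 0) w j *: y j = - \sum_(w j <= 0) w j *: y j] would have a
   nonnegative product with each [u i], positive for [w i <= 0], although
   [\sum_i l i *: u i = 0]. *)
Lemma simplex_alternative (u y : 'I_n.+1 -> 'rV[R]_n) :
  (forall i j, i != j -> 0 < dot (u i) (y j)) ->
  (exists r, forall i, 0 < dot (u i) r) \/
  (exists w : 'I_n.+1 -> R, [/\ forall i, 0 <= w i, \sum_i w i = 1 &
     \sum_i w i *: y i = 0]).
Proof.
move=> uy; have [|[l [l0 [i0 li0] lu]]] := @gordan n.+1 u isT; first by left.
have [r|] := pselect (exists r, forall i, 0 < dot (u i) r); first by left.
move=> _; right.
(* If [l j = 0], pairing the dependency with [y j] gives a zero sum of nonnegative terms whose term
   at [i0] is positive. *)
have lpos j : 0 < l j.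
  rewrite lt_def l0 andbT; apply/eqP => lj.
  have : dot (\sum_i l i *: u i) (y j) = 0 by rewrite lu dot0l.
  rewrite dot_suml => /psumr_eq0P => /(_ _ i0 isT) h.
  have i0j : i0 != j by apply: contraNneq li0 => ->; rewrite lj.
  have /eqP : dot (l i0 *: u i0) (y j) = 0.
    apply: h => i _; rewrite dotZl; have [->|ij] := eqVneq i j.
      by rewrite lj mul0r.
    by rewrite mulr_ge0// ltW// uy.
  by rewrite dotZl mulf_eq0 (negbTE li0) gt_eqF ?uy.
have [w [j0 _ wj0]] : exists2 w : 'I_n.+1 -> R,
    (exists2 i, i \in [set: 'I_n.+1]%SET & w i != 0) &
    ((\sum_(i in [set: 'I_n.+1]%SET) w i *: y i)%R <= (0 : 'M[R]_n)%R)%MS.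
  apply: (@linear_dependence _ _ _ _ _ 1%:M) => //.
  - by move=> i _; exact: submx1.
  - exact: sub0mx.
  - by rewrite mxrank1 mxrank0 addn0 cardsT card_ord.
rewrite submx0 => /eqP wy.
have {}wy : \sum_i w i *: y i = 0.
  by rewrite -[RHS]wy; apply: eq_bigl => i; rewrite finset.inE.
wlog wpos : w j0 wj0 wy / 0 < w j0 => [hw|].
  have [|w0] := ltP 0 (w j0); first exact: hw.
  apply: (hw (fun i => - w i) j0); first by rewrite oppr_eq0.
    by under eq_bigr do rewrite scaleNr; rewrite sumrN wy oppr0.
  by rewrite oppr_gt0 lt_neqAle wj0.
have wall i : 0 < w i.
  rewrite ltNge; apply/negP => wi.
  pose a := \sum_(j | 0 < w j) w j *: y j.
  have aE : a = \sum_(j | ~~ (0 < w j)) (- w j) *: y j.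
    under eq_bigr do rewrite scaleNr; rewrite sumrN.
    by move/eqP: wy; rewrite (bigID (fun j => 0 < w j))/= addr_eq0 => /eqP.
  have : dot (\sum_i l i *: u i) a = 0 by rewrite lu dot0l.
  rewrite dot_suml (bigID (fun j => 0 < w j))/= => /eqP; apply/negP.
  rewrite gt_eqF// ltr_wpDl//.
    apply: sumr_ge0 => k wk; rewrite dotZl mulr_ge0// aE dot_sumr.
    apply: sumr_ge0 => j wj; rewrite dotZr mulr_ge0//; first by rewrite oppr_ge0 leNgt.
    by rewrite ltW// uy//; apply: contraNneq wj => <-.
  have gt0 k : ~~ (0 < w k) -> 0 < dot (l k *: u k) a.
    move=> wk; rewrite dotZl mulr_gt0// /a dot_sumr.
    rewrite (bigD1 j0)//= ltr_pwDl//.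
      rewrite dotZr mulr_gt0// uy//; apply: contraNneq wk => ->; exact: wpos.
    apply: sumr_ge0 => j /andP[wj _]; rewrite dotZr mulr_ge0 ?(ltW wj)//.
    by rewrite ltW// uy//; apply: contraNneq wk => ->.
  rewrite (bigD1 i) -?leNgt//= ltr_pwDl ?gt0 -?leNgt//.
  by apply: sumr_ge0 => k /andP[wk _]; rewrite ltW// gt0.
pose s := \sum_i w i.
have s0 : 0 < s.
  rewrite /s (bigD1 j0)//= ltr_pwDl//.
  by apply: sumr_ge0 => i _; exact: ltW.
exists (fun i => w i / s); split.
- by move=> i; rewrite divr_ge0 ?ltW.
- by rewrite -mulr_suml mulfV// gt_eqF.
- under eq_bigr do rewrite mulrC -scalerA.
  by rewrite -scaler_sumr wy scaler0.
Qed.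

End Simplex.

(** * Reduction to [n + 1] points and the covering theorem *)

Section Covering.
Context {R : realType} {n : nat} (K : set 'rV[R]_n) (genK : generating_set K).

Lemma hull_comp (I J : finType) (x : I -> 'rV[R]_n) (h : J -> I) (Z : {set J}) :
  hull K (x \o h) Z = hull K x (h @: Z)%SET.
Proof.
congr (strong_hull K); apply/seteqP; split=> [_ [j jZ <-]|_ [_ /imsetP[j jZ ->] <-]].
  by exists (h j) => //; exact: imset_f.
by exists j.
Qed.

Lemma simplex_cover (y : 'I_n.+1 -> 'rV[R]_n) p :
  shifts K y finset.setT !=set0 -> hull K y finset.setT p ->
  (forall Z : {set 'I_n.+1}, (#|Z| <= n)%N -> ~ hull K y Z p) ->
  exists w : 'I_n.+1 -> R, [/\ forall i, 0 <= w i, \sum_i w i = 1 &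
    \sum_i w i *: y i = p].
Proof.
move=> sT Tp hp.
have cardC (i : 'I_n.+1) : (#|[set~ i]%SET| <= n)%N  by rewrite cardsC1 card_ord.
have sep (i : 'I_n.+1) : exists u,
    forall c, hull K y [set~ i]%SET c -> 0 < dot u (c - p).
  have [h0|hN0] := pselect (hull K y [set~ i]%SET !=set0); last first.
    by exists 0 => c hc; case: hN0; exists c.
  have [c hc [supc _]] := nearest_point p h0 (compact_hull genK sT (Z := _))
    (@convex_hullK _ _ _ _ y genK _).
  exists (c - p) => c' /supc.
  have : 0 < dot (c - p) (c - p).
    by rewrite dot_gt0 subr_eq0; apply/eqP => cp; apply: (hp _ (cardC i)); rewrite -cp.
  rewrite !dot_lin !(dotC p) !(dotC c'); lra.
have [u hu] := choice sep.
have [|[r hr]|[w [w0 w1 wy]]] := @simplex_alternative _ _ u (fun i => y i - p).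
- move=> i j ij; apply: hu; apply: mem_hull.
  by rewrite !finset.inE eq_sym.
(* Along the ray from [p] in direction [- r] no [dot (u i)] increases, so the ray misses every hull
   omitting one vertex; yet [ray_cover] finds on it a point covered by [n] indices, hence by such a
   hull. *)
- exfalso; have r0 : - r != 0.
    by rewrite oppr_eq0; apply/eqP => r0; have := hr ord0; rewrite r0 dot0r ltxx.
  have [t t0 [Z Zn Zt]] := ray_cover genK sT ord0 Tp r0.
  have [i iZ] : exists i, i \notin Z.
    apply/existsP; apply: contraT => /existsPn h.
    have ZT : Z = finset.setT by apply/setP => i; rewrite finset.inE -[LHS]negbK h.
    by move: Zn; rewrite ZT cardsT card_ord ltnn.
  have /hu : hull K y [set~ i]%SET (p + t *: - r).
    apply: hull_sub Zt; apply/fintype.subsetP => j jZ; rewrite !finset.inE.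
    by apply: contraNneq iZ => <-.
  rewrite addrAC subrr add0r dotZr dotNr mulrN oppr_gt0 ltNge => /negP; apply.
  by rewrite mulr_ge0// ltW.
- exists w; split=> //; move: wy; under eq_bigr do rewrite scalerBr.
  by rewrite sumrB -scaler_suml w1 scale1r => /eqP; rewrite subr_eq0 => /eqP.
Qed.

End Covering.

Theorem theorem1p5 (R : realType) (n : nat) (K X : set 'rV[R]_n)
    (genK : generating_set K) (finX : finite_set X)
    (XK : exists v : 'rV[R]_n, [set x + v | x in X] `<=` K) :
  strong_hull K X `\` convex_hull X `<=`
    \bigcup_(Y in [set Y : set 'rV[R]_n | Y `<=` X /\ Y #<= `I_n])
      strong_hull K Y.
Proof.
move=> p [Xp cXp]; have [s sX] := (finite_seqP X).1 finX.
pose x (i : 'I_(size s)) := s`_i.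
have xX i : X (x i) by rewrite sX /=; exact: mem_nth.
have XE : X = [set x i | i in [set` finset.setT]].
  apply/seteqP; split=> [a|_ [i _ <-]]; last exact: xX.
  rewrite sX => /= sa; have ia : (index a s < size s)%N by rewrite index_mem.
  by exists (Ordinal ia); rewrite /= ?finset.inE// /x/= nth_index.
have Tp : hull K x finset.setT p by rewrite /hull -XE.
have sT : shifts K x finset.setT !=set0.
  by have [v hv] := XK; exists v => i _; apply: hv; exists (x i).
(* For empty [X] there is no vertex to start from, but [X] itself is an admissible [Y]. *)
have [s0|] := posnP (size s).
  exists set0; last by rewrite (_ : set0 = X)// sX (size0nil s0); apply/seteqP; split.
  by split=> //; exact: card_ge0.
move=> s0; pose i0 := Ordinal s0.
suff [Z Zn Zp] : exists2 Z : {set 'I_(size s)}, (#|Z| <= n)%N & hull K x Z p.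
  exists [set x i | i in [set` Z]] => //; split=> [_ [i _ <-] //|].
  rewrite (_ : [set _ | _ in _] = [set x (enum_val k) | k in [set: 'I_#|Z|]]).
    apply: card_le_trans (card_image_le _ _) _.
    by rewrite -(card_le_eql card_II) card_le_II.
  apply/seteqP; split=> [_ [i iZ <-]|_ [k _ <-]].
    by exists (enum_rank_in iZ i) => //; rewrite enum_rankK_in.
  by exists (enum_val k) => //; exact: enum_valP.
apply: contrapT => nZ; apply: cXp.
have [Z Zn Zp] := cover_with_vertex genK sT i0 Tp.
(* [A] may have fewer than [n + 1] elements; the list is then padded with [i0], which belongs to
   [A], so the image of [h] is exactly [A]. *)
pose A := (i0 |: Z)%SET; pose h (k : 'I_n.+1) := nth i0 (enum A) k.
have cA : (#|A| <= n.+1)%N by rewrite cardsU1 (leq_add (leq_b1 _) Zn).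
have hA : (h @: finset.setT)%SET = A.
  apply/setP => i; apply/imsetP/idP => [[k _ ->]|iA].
    have [kA|kA] := ltnP k (size (enum A)).
      by rewrite -mem_enum mem_nth.
    by rewrite /h nth_default// /A finset.setU11.
  have iA' : (index i (enum A) < n.+1)%N.
    by rewrite (leq_trans _ cA)// cardE index_mem mem_enum.
  by exists (Ordinal iA'); rewrite ?finset.inE// /h/= nth_index// mem_enum.
have [|||w [w0 w1 <-]] := @simplex_cover R n K genK (x \o h) p.
- by have [v hv] := sT; exists v => k _; apply: hv; rewrite finset.inE.
- by rewrite hull_comp hA.
- move=> W Wn; rewrite hull_comp => Wp; apply: nZ.
  by exists (h @: W)%SET => //; exact: leq_trans (leq_imset_card _ _) Wn.
move=> C [cC XC].
have := @convex_combination _ _ C _ finset.setT (x \o h) w cC.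
rewrite !(eq_bigl _ _ (@finset.in_setT _)); apply => // i _.
by apply: XC; exact: xX.
Qed.
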